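(* Let $\pi\in\mathbb{R}^n\setminus\{0\}$, $\pi_0<\pi_1$ real, and $F=\{(x,t)\in\mathbb{R}^{n+1}:\pi_0\le\pi^Tx\le\pi_1\}$. Let $l\in\mathbb{R}\setminus\{0\}$ and $$H=\Bigl\{(x,t)\in\mathbb{R}^{n+1}:\sqrt{\|x\|_2^2+l^2}\le t\Bigr\}.$$ Let $$a=\frac{\sqrt{l^2\|\pi\|_2^2+\pi_1^2}-\sqrt{l^2\|\pi\|_2^2+\pi_0^2}}{\pi_1-\pi_0},\qquad b=\frac{\pi_1\sqrt{l^2\|\pi\|_2^2+\pi_0^2}-\pi_0\sqrt{l^2\|\pi\|_2^2+\pi_1^2}}{\pi_1-\pi_0}.$$ Then $$\mathrm{conv}\bigl(H\setminus \mathrm{int}(F)\bigr)=H\cap C,\qquad C=\Bigl\{(x,t)\in\mathbb{R}^{n+1}:\Bigl\|P_\pi^\perp x+\frac{a\pi^Tx+b}{\|\pi\|_2^2}\pi\Bigr\|_2\le t\Bigr\}.$$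
   Context: $P_\pi^\perp=I-\frac{\pi\pi^T}{\|\pi\|_2^2}$. $\mathrm{int}$ is the topological interior and $\mathrm{conv}$ the convex hull. *)

(* Defs.v *)
From HB Require Import structures.
From mathcomp Require Import all_boot all_order all_algebra.
From mathcomp Require Import all_classical all_reals all_analysis.
Set Implicit Arguments.
Unset Strict Implicit.
Unset Printing Implicit Defensive.
Import Order.TTheory GRing.Theory Num.Theory.
Import numFieldNormedType.Exports.
Local Open Scope classical_set_scope.
Local Open Scope ring_scope.

Section Definitions.
Context {R : realType}.

Definition convex_hull (M : lmodType R) (A : set M) : set M :=
  smallest (@convex_set R M) A.

Section EuclideanSpace.
Context {n : nat}.
Implicit Types (u x : 'cV[R]_n) (l a b : R).

Definition dotv u x : R := (u^T *m x) ord0 ord0.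

(* The library norm on matrices is the sup norm; this is the Euclidean one. *)
Definition norm2 x : R := Num.sqrt (\sum_(i < n) x i ord0 ^+ 2).

Definition proj_perp u : 'M[R]_n := 1%:M - (norm2 u ^+ 2)^-1 *: (u *m u^T).

(* R^(n+1) is represented as 'cV[R]_n * R^o, with the product topology; R^o is
   R seen as a module over itself, so that the product is an lmodType R. *)
Definition strip u (r0 r1 : R) : set ('cV[R]_n * R^o) :=
  [set p | r0 <= dotv u p.1 <= r1].

Definition hyperboloid l : set ('cV[R]_n * R^o) :=
  [set p | Num.sqrt (norm2 p.1 ^+ 2 + l ^+ 2) <= p.2].

Definition cone u a b : set ('cV[R]_n * R^o) :=
  [set p | norm2 (proj_perp u *m p.1
                  + ((a * dotv u p.1 + b) / norm2 u ^+ 2) *: u) <= p.2].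

End EuclideanSpace.
End Definitions.

(* Main.v *)
Require Import Defs.
From HB Require Import structures.
From mathcomp Require Import all_boot all_order all_algebra.
From mathcomp Require Import all_classical all_reals all_analysis.
From mathcomp Require Import ring lra.
Set Implicit Arguments.
Unset Strict Implicit.
Import Order.TTheory GRing.Theory Num.Theory.
Import numFieldNormedType.Exports.
Local Open Scope classical_set_scope.
Local Open Scope ring_scope.

(* Write d = u.x, v = |u|^2 and g(d) = sqrt (l^2 v + d^2).  Splitting x along u,
   membership in H reads v |Px|^2 + g(d)^2 <= v t^2, and membership in C is the
   same inequality with g replaced by its secant a d + b through r0 and r1.  Off
   ]r0, r1[ the convex g dominates the absolute value of its secant, so H \ int F
   is included in the convex set H `&` C.  Conversely, for r0 < d < r1, scaling
   the orthogonal part Px and t by g(r_i) / (a d + b) while moving d to r_i maps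
   a point of C into H (the inequality of C is homogeneous), and the point is a
   convex combination of its two images. *)

(** * Euclidean inner product and norm *)

Lemma dotvE (R : realType) (n : nat) (u x : 'cV[R]_n) :
  dotv u x = \sum_(i < n) u i ord0 * x i ord0.
Proof. by rewrite /dotv mxE; apply: eq_bigr => i _; rewrite mxE. Qed.

Lemma dotvC (R : realType) (n : nat) (u x : 'cV[R]_n) : dotv u x = dotv x u.
Proof. by rewrite !dotvE; apply: eq_bigr => i _; rewrite mulrC. Qed.

Lemma dotvDr (R : realType) (n : nat) (u x y : 'cV[R]_n) :
  dotv u (x + y) = dotv u x + dotv u y.
Proof. by rewrite /dotv mulmxDr mxE. Qed.

Lemma dotvZr (R : realType) (n : nat) (k : R) (u x : 'cV[R]_n) :
  dotv u (k *: x) = k * dotv u x.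
Proof. by rewrite /dotv -scalemxAr mxE. Qed.

Lemma dotvDl (R : realType) (n : nat) (x y u : 'cV[R]_n) :
  dotv (x + y) u = dotv x u + dotv y u.
Proof. by rewrite dotvC dotvDr !(dotvC u). Qed.

Lemma dotvZl (R : realType) (n : nat) (k : R) (x u : 'cV[R]_n) :
  dotv (k *: x) u = k * dotv x u.
Proof. by rewrite dotvC dotvZr (dotvC u). Qed.

Lemma dotv_ge0 (R : realType) (n : nat) (x : 'cV[R]_n) : 0 <= dotv x x.
Proof. by rewrite dotvE sumr_ge0// => i _; rewrite -expr2 sqr_ge0. Qed.

Lemma dotv_eq0 (R : realType) (n : nat) (x : 'cV[R]_n) :
  (dotv x x == 0) = (x == 0).
Proof.
rewrite dotvE psumr_eq0 => [|i _]; last by rewrite -expr2 sqr_ge0.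
apply/idP/eqP => [/allP h|->]; last first.
  by apply/allP => i _; rewrite /= mxE mulr0 eqxx.
apply/colP => i; rewrite mxE; apply/eqP.
by have := h i (mem_index_enum i); rewrite /= mulf_eq0 orbb.
Qed.

Lemma norm2E (R : realType) (n : nat) (x : 'cV[R]_n) :
  norm2 x = Num.sqrt (dotv x x).
Proof.
by rewrite /norm2 dotvE; congr Num.sqrt; apply: eq_bigr => i _; rewrite expr2.
Qed.

Lemma sqr_norm2 (R : realType) (n : nat) (x : 'cV[R]_n) :
  norm2 x ^+ 2 = dotv x x.
Proof. by rewrite norm2E sqr_sqrtr ?dotv_ge0. Qed.

Lemma norm2_ge0 (R : realType) (n : nat) (x : 'cV[R]_n) : 0 <= norm2 x.
Proof. exact: sqrtr_ge0. Qed.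

Lemma norm2_eq0 (R : realType) (n : nat) (x : 'cV[R]_n) :
  (norm2 x == 0) = (x == 0).
Proof. by rewrite -sqrf_eq0 sqr_norm2 dotv_eq0. Qed.

Lemma norm2Z (R : realType) (n : nat) (k : R) (x : 'cV[R]_n) :
  norm2 (k *: x) = `|k| * norm2 x.
Proof.
by rewrite !norm2E dotvZl dotvZr mulrA -expr2 sqrtrM ?sqr_ge0// sqrtr_sqr.
Qed.

(** Cauchy-Schwarz: for nonzero x and y, the squared norm of |y| x - |x| y equals 2 |x| |y| (|x| |y|
    - x.y) and is nonnegative. *)
Lemma dotv_le_norm2 (R : realType) (n : nat) (x y : 'cV[R]_n) :
  dotv x y <= norm2 x * norm2 y.
Proof.
have [->|x0] := eqVneq x 0.
  by rewrite -(scale0r 0) dotvZl mul0r mulr_ge0// norm2_ge0.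
have [->|y0] := eqVneq y 0.
  by rewrite -(scale0r 0) dotvZr mul0r mulr_ge0// norm2_ge0.
have nx : 0 < norm2 x by rewrite lt_neqAle norm2_ge0 eq_sym norm2_eq0 x0.
have ny : 0 < norm2 y by rewrite lt_neqAle norm2_ge0 eq_sym norm2_eq0 y0.
have := dotv_ge0 (norm2 y *: x + (- norm2 x) *: y).
rewrite !(dotvDl, dotvDr, dotvZl, dotvZr) -!sqr_norm2 (dotvC y x) => h.
rewrite -subr_ge0 -(pmulr_rge0 _ (mulr_gt0 nx ny)); nra.
Qed.

Lemma ler_norm2D (R : realType) (n : nat) (x y : 'cV[R]_n) :
  norm2 (x + y) <= norm2 x + norm2 y.
Proof.
rewrite -ler_sqr ?nnegrE ?addr_ge0 ?norm2_ge0//.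
rewrite sqrrD !sqr_norm2 dotvDl !dotvDr (dotvC y x).
by have := dotv_le_norm2 x y; lra.
Qed.

(** * Convexity of H and C *)

Lemma convex_norm2_le (R : realType) (m n : nat) (M : 'M[R]_(m, n))
    (c : 'cV[R]_m) :
  convex_set ([set p | norm2 (M *m p.1 + c) <= p.2] : set ('cV[R]_n * R^o)).
Proof.
move=> [x s] [y t] k; rewrite !inE /= => xs yt.
set z := (X in norm2 X).
have -> : z = k%:num *: (M *m x + c) + (1 - k%:num) *: (M *m y + c).
  rewrite /z mulmxDr -!scalemxAr !scalerDr addrACA -scalerDl.
  by rewrite addrCA subrr addr0 scale1r.
apply: le_trans (ler_norm2D _ _) _.
have k0 : 0 <= k%:num by [].
have k1 : 0 <= 1 - k%:num by rewrite subr_ge0.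
by rewrite !norm2Z !ger0_norm// lerD// ler_wpM2l.
Qed.

Lemma sqr_norm2_col_mx (R : realType) (m n : nat) (x : 'cV[R]_m)
    (y : 'cV[R]_n) :
  norm2 (col_mx x y) ^+ 2 = norm2 x ^+ 2 + norm2 y ^+ 2.
Proof. by rewrite !sqr_norm2 /dotv tr_col_mx mul_row_col mxE. Qed.

(** The square root is the norm of x stacked on l, an affine function of x, so [convex_norm2_le]
    applies. *)
Lemma hyperboloidE (R : realType) (n : nat) (l : R) :
  @hyperboloid R n l =
  [set p | norm2 (col_mx 1%:M 0 *m p.1 + col_mx 0 (l%:M : 'cV_1)) <= p.2].
Proof.
apply/funext => p; rewrite /hyperboloid /= mul_col_mx mul1mx mul0mx.
rewrite add_col_mx addr0 add0r -[norm2 (col_mx _ _)]ger0_norm ?norm2_ge0//.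
rewrite -sqrtr_sqr sqr_norm2_col_mx (sqr_norm2 l%:M) /dotv.
by rewrite tr_scalar_mx -scalar_mxM mxE eqxx expr2.
Qed.

Lemma proj_perp_mul (R : realType) (n : nat) (u x : 'cV[R]_n) :
  proj_perp u *m x = x - (dotv u x / norm2 u ^+ 2) *: u.
Proof.
rewrite /proj_perp mulmxBl mul1mx -scalemxAl -mulmxA; congr (_ - _).
by rewrite [u^T *m x]mx11_scalar mul_mx_scalar scalerA mulrC.
Qed.

(** Since (u.x) u = (u u^T) x, the vector in the norm is affine in x, as [convex_norm2_le]
    requires. *)
Lemma coneE (R : realType) (n : nat) (u : 'cV[R]_n) (a b : R) :
  cone u a b =
  [set p | norm2 ((proj_perp u + (a / norm2 u ^+ 2) *: (u *m u^T)) *m p.1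
                  + (b / norm2 u ^+ 2) *: u) <= p.2].
Proof.
apply/seteqP; split=> -[x t]; rewrite /cone /=;
  by rewrite (mulmxDl (proj_perp u)) -scalemxAl -mulmxA
    [u^T *m x]mx11_scalar mul_mx_scalar -/(dotv u x) scalerA -addrA -scalerDl mulrAC -mulrDl.
Qed.

(** * Membership as quadratic inequalities *)

Lemma sqrtr_leE (R : realType) (v t : R) : 0 <= v ->
  (Num.sqrt v <= t) = (0 <= t) && (v <= t ^+ 2).
Proof.
move=> v0; have [t0|t0] := leP 0 t; last first.
  by apply/negbTE; rewrite -ltNge (lt_le_trans t0)// sqrtr_ge0.
by rewrite -[in RHS](sqr_sqrtr v0) ler_sqr ?nnegrE ?sqrtr_ge0.
Qed.

Lemma mem_hyperboloid (R : realType) (n : nat) (l : R) (p : 'cV[R]_n * R^o) :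
  hyperboloid l p <-> 0 <= p.2 /\ dotv p.1 p.1 + l ^+ 2 <= p.2 ^+ 2.
Proof.
rewrite /hyperboloid /= sqr_norm2 sqrtr_leE; first by split=> /andP.
by rewrite addr_ge0 ?dotv_ge0 ?sqr_ge0.
Qed.

(** By orthogonality the squared norm is |Px|^2 + (a d + b)^2 / v, with |Px|^2 = |x|^2 - d^2 / v;
    multiplying by v clears the denominators. *)
Lemma mem_cone (R : realType) (n : nat) (u : 'cV[R]_n) (a b : R)
    (p : 'cV[R]_n * R^o) : u != 0 ->
  cone u a b p <-> 0 <= p.2 /\
    dotv u u * dotv p.1 p.1 - dotv u p.1 ^+ 2 + (a * dotv u p.1 + b) ^+ 2
    <= dotv u u * p.2 ^+ 2.
Proof.
rewrite -dotv_eq0 => u0.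
have up : 0 < dotv u u by rewrite lt_neqAle eq_sym u0 dotv_ge0.
rewrite /cone /= norm2E sqrtr_leE ?dotv_ge0//.
rewrite -[X in _ && X](ler_pM2l up).
rewrite proj_perp_mul sqr_norm2 -addrA -scaleNr -scalerDl.
rewrite !(dotvDl, dotvDr, dotvZl, dotvZr) (dotvC p.1 u).
set d := dotv u p.1; set v := dotv u u in u0 up *.
set X := (X in _ && (X <= _)); set Y := (Y in _ /\ (Y <= _)).
have -> : X = Y by rewrite /X /Y; field.
by split=> /andP.
Qed.

(** * Interior of the strip *)

Lemma dotv_continuous (R : realType) (n : nat) (u : 'cV[R]_n) :
  continuous (dotv u).
Proof.
move=> x; rewrite (_ : dotv u = fun x => \sum_(i < n) u i ord0 * x i ord0).
  apply: (@cvg_big _ _ _ _ _ add_continuous _ (nbhs x)) => i _.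
  by apply: cvgMr; exact: coord_continuous.
by apply/funext => y; rewrite dotvE.
Qed.

(** Around an interior point, moving x by a small multiple of u in either direction stays in the
    strip and shifts u.x by a nonzero amount, so both bounds are strict. Conversely, the open strip
    is the preimage of an open interval under a continuous map. *)
Lemma interior_strip (R : realType) (n : nat) (u : 'cV[R]_n) (r0 r1 : R) :
  u != 0 ->
  interior (strip u r0 r1) = [set p | r0 < dotv u p.1 < r1].
Proof.
rewrite -dotv_eq0 => u0.
have up : 0 < dotv u u by rewrite lt_neqAle eq_sym u0 dotv_ge0.
apply/seteqP; split=> [[x t] /= pF|].
  have fc : (fun e : R => x + e *: u) @ (0 : R) --> x.
    rewrite -[in X in _ --> X](addr0 x) -(scale0r u).
    by apply: cvgD; [exact: cvg_cst|apply: cvgZr_tmp; exact: cvg_id].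
  have : \forall e \near (0 : R), r0 <= dotv u (x + e *: u) <= r1.
    case: pF => -[P Q] /= [xP tQ] PQ.
    near=> e; apply: (PQ (_, t)); split=> /=; last exact: nbhs_singleton.
    by near: e; exact: fc.
  move=> /nbhs_ballP[e /= e0 ef].
  have eb k : `|k| = e / 2 -> r0 <= dotv u x + k * dotv u u <= r1.
    move=> ke; have /ef : ball 0 e k by rewrite /ball /= sub0r normrN ke; lra.
    by rewrite dotvDr dotvZr.
  have e2 : 0 < e / 2 by rewrite divr_gt0.
  have /andP[_ h1] := eb _ (gtr0_norm e2).
  have /andP[h2 _] := eb (- (e / 2)) (etrans (normrN _) (gtr0_norm e2)).
  by have ? := mulr_gt0 e2 up; apply/andP; split; lra.
rewrite -open_subsetE => [p /= /andP[h1 h2]|]; first by rewrite /strip /= !ltW.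
rewrite (_ : [set _ | _] = (fun p : 'cV[R]_n * R^o => dotv u p.1) @^-1` `]r0, r1[).
  apply: open_comp => [p _|]; last exact: itv_open.
  by apply: continuous_comp; [exact: cvg_fst|exact: dotv_continuous].
by apply/seteqP; split=> p; rewrite /= in_itv.
Unshelve. all: by end_near.
Qed.

(** The multiple of u added in q resets u.x to r and leaves the orthogonal part k Px. Multiplied by
    k^2, the inequality of C has the term (k (a d + b))^2, which the hypothesis turns into l^2 v +
    r^2: this is the inequality of H at q. *)
Lemma cone_homothety_mem_hyperboloid (R : realType) (n : nat) (u : 'cV[R]_n)
    (a b l r k : R) (p : 'cV[R]_n * R^o) :
  u != 0 -> 0 <= k -> cone u a b p ->
  l ^+ 2 * dotv u u + r ^+ 2 = (k * (a * dotv u p.1 + b)) ^+ 2 ->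
  let q := (k *: p.1 + ((r - k * dotv u p.1) / dotv u u) *: u, k * p.2) in
  dotv u q.1 = r /\ hyperboloid l q.
Proof.
move=> u0 k0 /(mem_cone _ _ _ u0)[t0 pC] kE /=.
have v0 : dotv u u != 0 by rewrite dotv_eq0.
have vp : 0 < dotv u u by rewrite lt_neqAle eq_sym v0 dotv_ge0.
split; first by rewrite dotvDr !dotvZr; field.
apply/mem_hyperboloid => /=; split; first exact: mulr_ge0.
rewrite -(ler_pM2l vp) !(dotvDl, dotvDr, dotvZl, dotvZr) (dotvC p.1 u).
have := ler_wpM2l (sqr_ge0 k) pC.
rewrite mulrDr -(exprMn 2 k (_ + b)) -kE.
set d := dotv u p.1; set v := dotv u u in v0 vp *; set X := (X in _ <= X -> _).
set Y := (X in X <= _ -> _) => YX.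
rewrite (_ : v * (k * p.2) ^+ 2 = X); last by rewrite /X; ring.
apply: le_trans YX; rewrite /Y le_eqVlt; apply/orP; left.
by apply/eqP; field.
Qed.

Unset Implicit Arguments.
Set Strict Implicit.

Theorem proposition4p1 (R : realType) (n : nat) (u : 'cV[R]_n) (r0 r1 l : R)
    (hu : u != 0) (hr : r0 < r1) (hl : l != 0) :
  let s0 := Num.sqrt (l ^+ 2 * norm2 u ^+ 2 + r0 ^+ 2) in
  let s1 := Num.sqrt (l ^+ 2 * norm2 u ^+ 2 + r1 ^+ 2) in
  let a := (s1 - s0) / (r1 - r0) in
  let b := (r1 * s0 - r0 * s1) / (r1 - r0) in
  convex_hull (hyperboloid l `\` interior (strip u r0 r1))
  = hyperboloid l `&` cone u a b.
Proof.
move=> s0 s1 a b.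
have v0 : dotv u u != 0 by rewrite dotv_eq0.
have vp : 0 < dotv u u by rewrite lt_neqAle eq_sym v0 dotv_ge0.
have lv : 0 < l ^+ 2 * dotv u u by rewrite mulr_gt0// exprn_even_gt0.
have e0 : l ^+ 2 * dotv u u + r0 ^+ 2 = s0 ^+ 2.
  by rewrite sqr_sqrtr sqr_norm2// addr_ge0 ?sqr_ge0// ltW.
have e1 : l ^+ 2 * dotv u u + r1 ^+ 2 = s1 ^+ 2.
  by rewrite sqr_sqrtr sqr_norm2// addr_ge0 ?sqr_ge0// ltW.
have s0p : 0 < s0 by rewrite sqrtr_gt0 sqr_norm2 ltr_wpDr ?sqr_ge0.
have s1p : 0 < s1 by rewrite sqrtr_gt0 sqr_norm2 ltr_wpDr ?sqr_ge0.
have r10 : r1 - r0 != 0 by rewrite subr_eq0 gt_eqF.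
have rp : 0 < r1 - r0 by rewrite subr_gt0.
rewrite interior_strip//.
apply/seteqP; split.
  apply: smallest_sub.
    move=> x y k; rewrite !in_setI => /andP[xH xC] /andP[yH yC].
    apply/andP; split.
      move: xH yH; rewrite hyperboloidE; exact: convex_norm2_le.
    by move: xC yC; rewrite coneE; exact: convex_norm2_le.
  move=> p [pH /= pF]; split=> //; apply/(mem_cone _ _ _ hu).
  have [t0 pt] := (mem_hyperboloid _ _).1 pH; split=> //.
  have := ler_wpM2l (ltW vp) pt; rewrite mulrDr (mulrC _ (l ^+ 2)).
  suff : (a * dotv u p.1 + b) ^+ 2 <= l ^+ 2 * dotv u u + dotv u p.1 ^+ 2 by lra.
  set d := dotv u p.1 in pF *.
  (* As s_i = a r_i + b, the quadratic l^2 v + d^2 - (a d + b)^2 vanishes at r0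
     and r1. *)
  have -> : l ^+ 2 * dotv u u + d ^+ 2 =
      (a * d + b) ^+ 2 + (1 - a ^+ 2) * ((d - r0) * (d - r1)).
    (* Both s_i^2 - r_i^2 equal l^2 v; interpolating them with the weights of d eliminates l, and
       the identity becomes rational in s_i, r_i and d. *)
    have -> : l ^+ 2 * dotv u u =
        (s0 ^+ 2 - r0 ^+ 2) + (d - r0) / (r1 - r0) *
          ((s1 ^+ 2 - r1 ^+ 2) - (s0 ^+ 2 - r0 ^+ 2)).
      by rewrite -e0 -e1; ring.
    by rewrite /a /b; field.
  rewrite lerDl; apply: mulr_ge0.
    rewrite subr_ge0 /a expr_div_n ler_pdivrMr ?exprn_gt0// mul1r.
    (* After expansion, a^2 <= 1 amounts to this bound: Cauchy-Schwarz for (l |u|, r0) and (l |u|,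
       r1). The left side may be negative, hence the absolute value before squaring. *)
    have h : l ^+ 2 * dotv u u + r0 * r1 <= s0 * s1.
      apply: le_trans (ler_norm _) _.
      rewrite -ler_sqr ?nnegrE ?normr_ge0 ?(ltW (mulr_gt0 s0p s1p))//.
      rewrite real_normK ?num_real//.
      rewrite exprMn -e0 -e1 -subr_ge0.
      have -> : (l ^+ 2 * dotv u u + r0 ^+ 2) * (l ^+ 2 * dotv u u + r1 ^+ 2)
        - (l ^+ 2 * dotv u u + r0 * r1) ^+ 2
        = (l ^+ 2 * dotv u u) * (r1 - r0) ^+ 2 by ring.
      by rewrite mulr_ge0 ?sqr_ge0// ltW.
    by rewrite !sqrrB -e0 -e1; lra.
  have [dr|dr] := leP d r0; first by apply: mulr_le0; lra.
  have [dr'|dr'] := leP r1 d; first by apply: mulr_ge0; lra.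
  by case: pF; rewrite dr dr'.
move=> p [pH pC] A [Aconv HA].
have [pF|] := boolP (r0 < dotv u p.1 < r1); last first.
  by move=> /negP pF; apply: HA; split.
move: (pF) => /andP[]; set d := dotv u p.1 in pF * => d0 d1.
set c := a * d + b.
(* The weight for which d = k r0 + (1 - k) r1; the secant then takes the value c = k s0 + (1 - k) s1
   > 0 at d. *)
pose k := (r1 - d) / (r1 - r0).
have k0 : 0 < k by rewrite divr_gt0// subr_gt0.
have k1 : k < 1 by rewrite ltr_pdivrMr// mul1r; lra.
have cE : c = k * s0 + (1 - k) * s1 by rewrite /c /a /b /k; field.
have cp : 0 < c by rewrite cE addr_gt0// mulr_gt0// subr_gt0.
have cn : c != 0 by rewrite gt_eqF.
(* The factor s / c sends the secant value c to s; the image lies over r, outside the open strip,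
   hence in [A]. *)
have h s r : 0 < s -> l ^+ 2 * dotv u u + r ^+ 2 = s ^+ 2 -> ~~ (r0 < r < r1) ->
    A ((s / c) *: p.1 + ((r - (s / c) * d) / dotv u u) *: u, (s / c) * p.2).
  move=> sp es rn; apply: HA.
  have [||qr qH] :=
      @cone_homothety_mem_hyperboloid _ _ u a b l r (s / c) p hu _ pC.
  - by rewrite divr_ge0// ltW.
  - by rewrite divfK.
  by split=> //=; rewrite qr; exact/negP.
have A0 := h _ _ s0p e0 _; have A1 := h _ _ s1p e1 _.
rewrite !ltxx andbF /= in A0 A1.
have := Aconv _ _ (Itv01 (ltW k0) (ltW k1)) (mem_set (A0 isT)) (mem_set (A1 isT)).
move=> /set_mem; congr (A _).
(* The two scale factors average to 1, which restores x and t; with [kd], the two shifts along u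
   cancel. *)
have kc : k * (s0 / c) + (1 - k) * (s1 / c) = 1.
  by rewrite !mulrA -mulrDl -cE divff.
have kd : k * r0 + (1 - k) * r1 = d by rewrite /k; field.
rewrite [LHS]surjective_pairing [RHS]surjective_pairing; congr pair => /=.
  rewrite /unstable.onem !scalerDr addrACA !scalerA -!scalerDl kc scale1r.
  rewrite [X in _ + X *: _](_ : _ = 0) ?scale0r ?addr0//.
  transitivity ((k * r0 + (1 - k) * r1 -
    (k * (s0 / c) + (1 - k) * (s1 / c)) * d) / dotv u u).
    by field; rewrite v0.
  by rewrite kc kd mul1r subrr mul0r.
transitivity ((k * (s0 / c) + (1 - k) * (s1 / c)) * p.2).
  by rewrite mulrDl -(mulrA k) -(mulrA (1 - k)).
by rewrite kc mul1r.
Qed.
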